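(* For $\lambda\in(0,1)$ and $r\in[-1,1]\setminus\{0\}$, let $f_{r,\lambda}(x)=[1-\lambda+\lambda x^r]^{1/r}$. Assume that $T=U|T|\in\mathcal{B}(H)$ is invertible and centered. If $T\in\mathcal{K}(H)$ or $T$ is an $n\times n$ matrix, then $\lim_{n\to\infty}\Delta_{f_{r,\lambda}}^n(T)$ exists. Moreover, the limit point does not depend on $\lambda$.
   Context: $H$ is a complex Hilbert space, $\mathcal{B}(H)$ the bounded operators, $\mathcal{K}(H)$ the compact operators on $H$, $|T|=(T^*T)^{1/2}$; limits of operators are in the strong operator topology. If $T$ is invertible, $U$ in the polar decomposition $T=U|T|$ is unitary. The functions $f=f_{r,\lambda}$ are representing functions of operator means (power means): operator monotone on $(0,\infty)$ with $f(1)=1$. Induced Aluthge transformation: for invertible $T=U|T|$ with spectral decomposition $|T|=\int_{\sigma(|T|)}s\,dE_s$, define $\Delta_f(T):=\int_{\sigma(|T|)}\int_{\sigma(|T|)} s f(t/s)\,dE_s\,U\,dE_t$ (double operator integral). Concretely (known fact), if $\mu$ is a probability measure on $[0,1]$ with $f(x)=\int_0^1[1-\theta+\theta x^{-1}]^{-1}d\mu(\theta)$ for $x>0$ (such $\mu$ exists), then $\Delta_f(T)=\int_0^1\int_0^\infty e^{-(1-\theta)s|T|^{-1}}\,U\,e^{-\theta s|T|^{-1}}\,ds\,d\mu(\theta)$. Iterates: $\Delta_f^0(T)=T$, $\Delta_f^n(T)=\Delta_f(\Delta_f^{n-1}(T))$. $T=U|T|$ is centered if $\{U^{*m}|T|U^m,\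 |T|,\ U^n|T|U^{*n}: n,m=1,2,\dots\}$ is a commuting set. *)

(* Defs.v *)
From HB Require Import structures.
From mathcomp Require Import all_boot all_order all_algebra.
From mathcomp Require Import all_classical all_reals all_analysis.
From mathcomp Require Import complex.

Set Implicit Arguments.
Unset Strict Implicit.
Unset Printing Implicit Defensive.

Import Order.TTheory GRing.Theory Num.Theory Num.Def.
Import numFieldNormedType.Exports.

Local Open Scope classical_set_scope.
Local Open Scope ring_scope.
Local Open Scope complex_scope.

(* A complex Hilbert space is a complete normed space [H] over [R[i]] whose
   norm comes from an inner product [ip], linear in its first argument.
   Operators are functions [H -> H], those of B(H) being singled out by
   [bounded_op].  Objects that exist and are unique by a theorem (adjoint, |T|,
   polar part, Delta_f(T)) are the choice, by [xget], of the element satisfying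
   the defining property; [xget] returns the zero operator if there is none. *)

Section Operators.
Variables (R : realType) (H : completeNormedModType R[i]).
Variable ip : {dot H for conjC}.

Definition hilbert_norm : Prop := forall x : H, `|x| ^+ 2 = ip x x.

Definition bounded_op (A : H -> H) : Prop := linear A /\ continuous A.

Definition invertible_op (A : H -> H) : Prop :=
  exists B, [/\ bounded_op B, B \o A = id & A \o B = id].

Definition spectrum (A : H -> H) : set R[i] :=
  [set z | ~ invertible_op (fun x => A x - z *: x)].

Definition real_spectrum (A : H -> H) : set R :=
  [set s | spectrum A s%:C].

Definition compact_op (A : H -> H) : Prop :=
  bounded_op A /\ precompact (A @` [set x | `|x| <= 1]).

(* [H] is C^n, up to the choice of an orthonormal basis [e]: the operators
   on [H] are then the n x n matrices. *)
Definition is_Cn (n : nat) : Prop :=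
  exists e : 'I_n -> H,
    (forall i j, ip (e i) (e j) = (i == j)%:R) /\
    (forall x, x = \sum_(i < n) ip x (e i) *: e i).

Definition is_adjoint (A B : H -> H) : Prop :=
  bounded_op B /\ (forall x y, ip (A x) y = ip x (B y)).

Definition adjoint (A : H -> H) : H -> H :=
  xget (fun=> 0) [set B | is_adjoint A B].

Definition positive_op (A : H -> H) : Prop :=
  bounded_op A /\ (forall x, 0 <= ip (A x) x).

Definition is_abs_op (T P : H -> H) : Prop :=
  positive_op P /\ P \o P = adjoint T \o T.

Definition abs_op (T : H -> H) : H -> H :=
  xget (fun=> 0) [set P | is_abs_op T P].

(* T = U|T| with U a partial isometry such that ker U = ker T. *)
Definition is_polar_part (T U : H -> H) : Prop :=
  [/\ bounded_op U,
      U \o adjoint U \o U = U,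
      (forall x, U x = 0 <-> T x = 0) &
      T = U \o abs_op T].

Definition polar_part (T : H -> H) : H -> H :=
  xget (fun=> 0) [set U | is_polar_part T U].

Definition centered_family (T : H -> H) : set (H -> H) :=
  let U := polar_part T in
  let Us := adjoint U in
  [set A | [\/ exists m, (0 < m)%N /\ A = iter m Us \o abs_op T \o iter m U,
               A = abs_op T |
               exists n, (0 < n)%N /\ A = iter n U \o abs_op T \o iter n Us]].

Definition centered (T : H -> H) : Prop :=
  forall A B, centered_family T A -> centered_family T B -> A \o B = B \o A.

Definition orthogonal_projection (P : H -> H) : Prop :=
  [/\ bounded_op P, P \o P = P & forall x y, ip (P x) y = ip x (P y)].

(* Projection-valued measures on the Borel sets of R (the values of [E] on
   other sets are irrelevant). *)
Definition spectral_measure (E : set (measurableTypeR R) -> H -> H) : Prop :=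
  [/\ forall B, measurable B -> orthogonal_projection (E B),
      E setT = id,
      forall B C, measurable B -> measurable C -> E (B `&` C) = E B \o E C &
      forall F : nat -> set (measurableTypeR R),
        (forall k, measurable (F k)) -> trivIset setT F ->
        forall x,
          (fun n => \sum_(k < n) E (F k) x) @ \oo --> E (\bigcup_k F k) x].

(* [B] is a partition of [S] into [n] Borel sets of diameter at most [delta],
   with tags [t i] in [B i]. *)
Definition tagged_partition (S : set (measurableTypeR R)) (delta : R) (n : nat)
    (B : 'I_n -> set (measurableTypeR R)) (t : 'I_n -> R) : Prop :=
  [/\ forall i, measurable (B i),
      trivIset setT B,
      \bigcup_i B i = S,
      forall i, B i (t i) &
      forall i x y, B i x -> B i y -> `|x - y| <= delta].

(* A = \int_S phi(s) dE_s, as the strong limit of Riemann sums. *)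
Definition is_spectral_integral (E : set (measurableTypeR R) -> H -> H)
    (S : set R) (phi : R -> R) (A : H -> H) : Prop :=
  forall (x : H) (eps : R), 0 < eps -> exists2 delta : R, 0 < delta &
    forall n (B : 'I_n -> set (measurableTypeR R)) (t : 'I_n -> R),
      tagged_partition S delta B t ->
      `|A x - \sum_(i < n) (phi (t i))%:C *: E (B i) x| <= eps%:C.

(* D = \int_S \int_S phi(s, t) dE_s X dE_t, as the strong limit of Riemann
   sums. *)
Definition is_double_operator_integral
    (E : set (measurableTypeR R) -> H -> H) (S : set R) (phi : R -> R -> R)
    (X D : H -> H) : Prop :=
  forall (x : H) (eps : R), 0 < eps -> exists2 delta : R, 0 < delta &
    forall n (B : 'I_n -> set (measurableTypeR R)) (s : 'I_n -> R)
           m (C : 'I_m -> set (measurableTypeR R)) (t : 'I_m -> R),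
      tagged_partition S delta B s -> tagged_partition S delta C t ->
      `|D x - \sum_(i < n) \sum_(j < m)
                (phi (s i) (t j))%:C *: E (B i) (X (E (C j) x))| <= eps%:C.

(* E is the spectral measure of the self-adjoint operator A:
   it is carried by the spectrum and A = \int s dE_s. *)
Definition spectral_decomposition (A : H -> H)
    (E : set (measurableTypeR R) -> H -> H) : Prop :=
  [/\ spectral_measure E,
      E (real_spectrum A) = id &
      is_spectral_integral E (real_spectrum A) id A].

Definition is_Aluthge (f : R -> R) (T D : H -> H) : Prop :=
  bounded_op D /\
  exists2 E, spectral_decomposition (abs_op T) E &
    is_double_operator_integral E (real_spectrum (abs_op T))
      (fun s t => s * f (t / s)) (polar_part T) D.

Definition Aluthge (f : R -> R) (T : H -> H) : H -> H :=
  xget (fun=> 0) [set D | is_Aluthge f T D].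

Definition strong_cvg (A : nat -> H -> H) (L : H -> H) : Prop :=
  bounded_op L /\ (forall x, (fun n => A n x) @ \oo --> L x).

End Operators.

Definition power_mean (R : realType) (r lambda x : R) : R :=
  (1 - lambda + lambda * x `^ r) `^ r^-1.

(* Main.v *)
(* A compact invertible operator forces H to be finite-dimensional.  Let
   T = U|T| be centered.  The operators U^{*k} |T| U^k commute, so they are
   diagonal in a common orthonormal basis e; let q_k(i) be the eigenvalues.
   If u_ij = <U e_j, e_i> is nonzero, then q_k(i) = q_{k+1}(j).  Since U is
   invertible, some term of the Leibniz formula for det u is nonzero, which gives
   a permutation s with u_{s(j), j} != 0, hence q_{k+1} = q_k o s.
   In this basis Delta_f(T) has entries q_0(i) f(q_0(j) / q_0(i)) u_ij, that is,
   Delta_f(T) = U diag(q') with q'(j) = q_0(s j) f(q_0(j) / q_0(s j)); for the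
   power mean, h = q^r evolves by h |-> (1 - lambda) h o s + lambda h.
   These lazy averages converge to the mean of h over the orbits of s, which does
   not depend on lambda. *)

Require Import Defs.
From HB Require Import structures.
From mathcomp Require Import all_boot all_order all_algebra all_fingroup ring.
From mathcomp Require Import all_classical all_reals all_analysis.
From mathcomp Require Import finmap complex.

Import Order.TTheory GRing.Theory Num.Theory Num.Def.
Import numFieldNormedType.Exports.

Local Open Scope classical_set_scope.
Local Open Scope ring_scope.
Local Open Scope complex_scope.

Set Implicit Arguments.
Unset Strict Implicit.
Unset Printing Implicit Defensive.

(** * Algebra of the inner product *)

Section InnerProduct.
Variables (R : realType) (H : completeNormedModType R[i]).
Variable ip : {dot H for conjC}.
Implicit Types (x y z : H) (a : R[i]).

Lemma ipC x y : ip x y = conjC (ip y x).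
Proof. by rewrite (hermC ip x y) expr0 mul1r. Qed.

Lemma ipDl x y z : ip (x + y) z = ip x z + ip y z.
Proof. exact: linearDl. Qed.

Lemma ipZl a x z : ip (a *: x) z = a * ip x z.
Proof. exact: linearZl_LR. Qed.

Lemma ipZr a x z : ip x (a *: z) = conjC a * ip x z.
Proof. by rewrite ipC ipZl rmorphM /= -ipC. Qed.

Lemma ipDr x y z : ip z (x + y) = ip z x + ip z y.
Proof. by rewrite ipC ipDl rmorphD /= -!ipC. Qed.

Lemma ip0l z : ip 0 z = 0.
Proof. by rewrite -(scale0r (0 : H)) ipZl mul0r. Qed.

Lemma ip0r z : ip z 0 = 0.
Proof. by rewrite ipC ip0l rmorph0. Qed.

Lemma ipBl x y z : ip (x - y) z = ip x z - ip y z.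
Proof. by rewrite ipDl -scaleN1r ipZl mulN1r. Qed.

Lemma ipBr x y z : ip z (x - y) = ip z x - ip z y.
Proof. by rewrite ipC ipBl rmorphB /= -!ipC. Qed.

Lemma ip_suml I (s : seq I) (P : pred I) (F : I -> H) z :
  ip (\sum_(i <- s | P i) F i) z = \sum_(i <- s | P i) ip (F i) z.
Proof. by apply: (big_morph (ip^~ z)) => [x y|]; rewrite ?ipDl ?ip0l. Qed.

Lemma ip_sumr I (s : seq I) (P : pred I) (F : I -> H) z :
  ip z (\sum_(i <- s | P i) F i) = \sum_(i <- s | P i) ip z (F i).
Proof. by apply: (big_morph (ip z)) => [x y|]; rewrite ?ipDr ?ip0r. Qed.

Lemma ip_eq0 x : ip x x = 0 -> x = 0.
Proof. by move/eqP; rewrite dnorm_eq0 => /eqP. Qed.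

Lemma ip_inj x y : (forall z, ip x z = ip y z) -> x = y.
Proof.
move=> xy; apply/eqP; rewrite -subr_eq0; apply/eqP/ip_eq0.
by rewrite ipBl xy subrr.
Qed.

End InnerProduct.

(** * Operators in a finite orthonormal basis *)

Section OrthonormalBasis.
Variables (R : realType) (H : completeNormedModType R[i]).
Variable ip : {dot H for conjC}.
Hypothesis hH : hilbert_norm ip.
Implicit Types (x y z : H) (a : R[i]) (A B : H -> H).

Definition orthonormal_family n (e : 'I_n -> H) :=
  forall i j, ip (e i) (e j) = (i == j)%:R.

Definition orthonormal_basis n (e : 'I_n -> H) :=
  orthonormal_family e /\ forall x, x = \sum_(i < n) ip x (e i) *: e i.

(** The component of [x] orthogonal to [e] has squared norm [|x|^2 - |ip x e|^2], which is
    nonnegative. *)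
Lemma ler_ip_unit x e : ip e e = 1 -> `|ip x e| <= `|x|.
Proof.
move=> e1; rewrite -ler_sqr ?nnegrE ?normr_ge0// hH normCK.
have : 0 <= ip (x - ip x e *: e) (x - ip x e *: e) by rewrite -hH exprn_ge0.
rewrite ipBl !ipBr !ipZl !ipZr e1 (ipC ip e x) mulr1.
by rewrite [X in _ - X](_ : _ = 0) ?subr0 ?subr_ge0 1?mulrC// subrr.
Qed.

Lemma ip_unit_continuous e : ip e e = 1 -> continuous (fun x => ip x e : (R[i] : numFieldType)).
Proof.
move=> e1 x; apply/cvgrPdist_lt => eps eps0; near=> y.
by rewrite -ipBl (le_lt_trans (ler_ip_unit _ e1)).
Unshelve. all: by end_near.
Qed.

Lemma cvg_sum_fin (T : Type) (F : set_system T) (FF : Filter F) n (f : 'I_n -> T -> H)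
    (l : 'I_n -> H) :
  (forall i, f i @ F --> l i) -> (fun t => \sum_(i < n) f i t) @ F --> \sum_(i < n) l i.
Proof. move=> fl.
by refine (cvg_big (op := +%R) (P := xpredT) _ _ (fun i _ => fl i)); exact: add_continuous. Qed.

Definition basis_op n (e v : 'I_n -> H) x : H := \sum_(i < n) ip x (e i) *: v i.

Lemma basis_op_linear n (e v : 'I_n -> H) : linear (basis_op e v).
Proof.
move=> a x y; rewrite /basis_op scaler_sumr -big_split /=; apply: eq_bigr => i _.
by rewrite ipDl ipZl scalerDl scalerA.
Qed.

Lemma basis_op_bounded n (e v : 'I_n -> H) :
  orthonormal_family e -> bounded_op (basis_op e v).
Proof.
move=> oe; split; first exact: basis_op_linear.
move=> x; apply: cvg_sum_fin => i; apply: cvgZr_tmp.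
by apply: ip_unit_continuous; rewrite oe eqxx.
Qed.

Lemma sum_delta n (i : 'I_n) (F : 'I_n -> H) :
  \sum_(j < n) (i == j)%:R *: F j = F i :> H.
Proof.
rewrite (bigD1 i) //= eqxx scale1r big1 ?addr0 // => j /negPf.
by rewrite eq_sym => ->; rewrite scale0r.
Qed.

Lemma basis_opE n (e v : 'I_n -> H) i :
  orthonormal_family e -> basis_op e v (e i) = v i.
Proof.
by move=> oe; rewrite /basis_op; under eq_bigr do rewrite oe; rewrite sum_delta.
Qed.

Section LinearMap.
Variables (A : H -> H) (Alin : linear A).
Lemma linD x y : A (x + y) = A x + A y.
Proof. by have := Alin 1 x y; rewrite !scale1r. Qed.
Lemma lin0 : A 0 = 0.
Proof. by apply: (addIr (A 0)); rewrite -linD !add0r. Qed.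
Lemma linZ a x : A (a *: x) = a *: A x.
Proof. by have := Alin a x 0; rewrite lin0 !addr0. Qed.
Lemma linB x y : A (x - y) = A x - A y.
Proof. by rewrite linD -scaleN1r linZ scaleN1r. Qed.
Lemma lin_sum I (s : seq I) (P : pred I) (F : I -> H) :
  A (\sum_(i <- s | P i) F i) = \sum_(i <- s | P i) A (F i).
Proof. by apply: (big_morph A) => [x y|]; rewrite ?linD ?lin0. Qed.
End LinearMap.

Lemma linear_comp A B : linear A -> linear B -> linear (A \o B).
Proof. by move=> Al Bl a x y /=; rewrite Bl Al. Qed.

Lemma linear_iter A k : linear A -> linear (iter k A).
Proof. by move=> Al; elim: k => [|k IH] a x y //=; rewrite IH Al. Qed.

Section Basis.
Variables (n : nat) (e : 'I_n -> H) (be : orthonormal_basis e).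
Let oe := be.1.

Lemma linear_basis_op A : linear A -> A = basis_op e (A \o e).
Proof.
move=> Al; apply/funext => x; rewrite {1}(be.2 x) (lin_sum Al) /basis_op.
by apply: eq_bigr => i _; rewrite (linZ Al).
Qed.

Lemma linear_bounded_op A : linear A -> bounded_op A.
Proof. by move=> Al; rewrite (linear_basis_op Al); exact: basis_op_bounded. Qed.

Lemma eq_linear A B : linear A -> linear B -> (forall i, A (e i) = B (e i)) -> A = B.
Proof.
move=> Al Bl AB; rewrite (linear_basis_op Al) (linear_basis_op Bl).
by congr basis_op; apply/funext.
Qed.

Lemma eq_basis x y : (forall i, ip x (e i) = ip y (e i)) -> x = y.
Proof. by move=> xy; rewrite (be.2 x) (be.2 y); under eq_bigr do rewrite xy. Qed.

Lemma parseval x y : ip x y = \sum_(i < n) ip x (e i) * conjC (ip y (e i)).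
Proof.
rewrite {1}(be.2 x) ip_suml; apply: eq_bigr => i _.
by rewrite ipZl (ipC ip (e i)).
Qed.

(** The adjoint is written out from the values of [A] on the basis, so that the choice [adjoint] is
    a genuine adjoint and not its default value. *)
Lemma adjoint_exists A : linear A -> exists B, is_adjoint ip A B.
Proof.
move=> Al; exists (fun y => \sum_(i < n) ip y (A (e i)) *: e i); split.
  apply: linear_bounded_op => a x y.
  rewrite scaler_sumr -big_split /=; apply: eq_bigr => i _.
  by rewrite ipDl ipZl scalerDl scalerA.
move=> x y; rewrite {1}(be.2 x) (lin_sum Al) ip_suml ip_sumr.
apply: eq_bigr => i _; rewrite (linZ Al) ipZl ipZr mulrC.
by rewrite -(ipC ip).
Qed.

Lemma adjointP A : linear A -> is_adjoint ip A (adjoint ip A).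
Proof. by move=> /adjoint_exists[B AB]; exact: (xgetPex (fun=> 0) (ex_intro _ B AB)). Qed.

Lemma adjoint_linear A : linear A -> linear (adjoint ip A).
Proof. by case/adjointP => [[]]. Qed.

Lemma ip_adjoint A x y : linear A -> ip (A x) y = ip x (adjoint ip A y).
Proof. by case/adjointP => _ ->. Qed.

Lemma ip_adjointl A x y : linear A -> ip (adjoint ip A x) y = ip x (A y).
Proof. by move=> Al; rewrite ipC -ip_adjoint// -(ipC ip). Qed.

End Basis.

End OrthonormalBasis.

(** * Unitary triangularization of commuting matrices *)

Local Open Scope sesquilinear_scope.

(** A finite subset whose span has maximal rank works: adding a member of [S] cannot raise the rank,
    so that member already lies in the span. *)
Lemma finite_spanning_subset (F : fieldType) m (S : set 'rV[F]_m) :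
  exists s : seq 'rV[F]_m, (forall A, A \in s -> S A) /\
    forall A, S A -> (A <= \sum_(B <- s) <<B>>)%MS.
Proof.
pose P k := `[< exists s : seq 'rV[F]_m, (forall A, A \in s -> S A) /\
  \rank (\sum_(B <- s) <<B>>)%MS = k >].
have P0 : exists k, P k by exists 0%N; apply/asboolP; exists [::]; rewrite big_nil mxrank0.
have Pb k : P k -> (k <= m)%N by move=> /asboolP[s [_ <-]]; exact: rank_leq_col.
case: (ex_maxnP P0 Pb) => k /asboolP[s [sS rk]] kmax.
exists s; split=> // A SA.
set W := (\sum_(B <- s) _)%MS in rk *.
have WA : (W <= <<A>> + W)%MS by rewrite addsmxSr.
have : P (\rank (<<A>> + W)%MS).
  apply/asboolP; exists (A :: s); rewrite big_cons; split=> // B.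
  by rewrite inE => /predU1P[->//|/sS].
move/kmax; rewrite -rk => rle.
apply: submx_trans (_ : (<<A>> + W <= W)%MS).
  by apply: submx_trans (addsmxSl _ _); rewrite genmxE.
by rewrite -(mxrank_leqif_sup WA) eqn_leq (mxrankS WA) rle.
Qed.

(** Triangularizing a finite spanning subset suffices, because the vanishing of an entry after
    conjugation by [V] is a linear condition on [A]. *)
Lemma unitary_cotriangularization (C : numClosedFieldType) n (S : set 'M[C]_n) :
  (forall A B, S A -> S B -> A *m B = B *m A) ->
  exists2 V : 'M[C]_n, V \is unitarymx &
    forall A, S A -> is_trig_mx (V *m A *m V^t*).
Proof.
move=> Scomm.
have [s [sS spanS]] := finite_spanning_subset [set mxvec A | A in S].
have [|V Vu /allP Vs] := @cotrigonalization C n [seq vec_mx v | v <- s].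
  move=> _ _ /mapP[_ /sS[A SA <-] ->] /mapP[_ /sS[B SB <-] ->].
  by rewrite !mxvecK; exact: Scomm.
exists V => // A SA; apply/is_trig_mxP => i j ij.
(* [l] is the linear form on vectorized matrices that reads off the entry [(i, j)] of the conjugate
   by [V]; its kernel contains the spanning subset. *)
pose l := lin_mx (mulmx (row i V)) *m lin_mx (mulmxr (col j (V^t*))).
have lE (B : 'M[C]_n) : mxvec B *m l = mxvec (row i V *m B *m col j (V^t*)).
  by rewrite mulmxA !mul_vec_lin.
have entry (B : 'M[C]_n) : (V *m B *m V^t*) i j = (row i V *m B *m col j (V^t*)) 0 0.
  by rewrite -row_mul !mxE; apply: eq_bigr => k _; rewrite !mxE.
have : (mxvec A <= kermx l)%MS.
  apply: submx_trans (spanS _ (ex_intro2 _ _ A SA erefl)) _.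
  rewrite big_seq; elim/big_ind : _ => [|X Y hX hY|v vs]; first exact: sub0mx.
    by rewrite addsmx_sub hX.
  rewrite genmxE; have [B SB Bv] := sS _ vs; apply/sub_kermxP.
  have /Vs : B \in [seq vec_mx v | v <- s] by apply/mapP; exists v; rewrite // -Bv mxvecK.
  rewrite /= /similar_to conjymx// => /is_trig_mxP/(_ i j ij); rewrite entry => B0.
  rewrite -Bv lE; apply/eqP; rewrite mxvec_eq0; apply/eqP/matrixP => a b.
  by rewrite !ord1 B0 mxE.
move/sub_kermxP; rewrite lE => /eqP; rewrite mxvec_eq0 => /eqP A0.
by rewrite entry A0 mxE.
Qed.

(** * Simultaneous diagonalization of self-adjoint operators *)

Section SimultaneousDiagonalization.
Variables (R : realType) (H : completeNormedModType R[i]).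
Variable ip : {dot H for conjC}.
Hypothesis hH : hilbert_norm ip.

(** Orthonormality is [V V^* = 1], and completeness is [V^* V = 1]. *)
Lemma unitary_basis n (e : 'I_n -> H) (V : 'M[R[i]]_n) :
  orthonormal_basis ip e -> V \is unitarymx ->
  orthonormal_basis ip (fun i => \sum_j V i j *: e j).
Proof.
move=> be Vu; have oe := be.1; split=> [i j|x].
  have /matrixP/(_ i j) := unitarymxP Vu; rewrite !mxE => <-.
  rewrite ip_suml; apply: eq_bigr => k _; rewrite ipZl ip_sumr !mxE; congr (_ * _).
  rewrite (bigD1 k)//= big1 ?addr0 => [|l /negPf lk]; rewrite ipZr oe ?eqxx ?mulr1//.
  by rewrite eq_sym lk mulr0.
apply: (eq_basis be) => k; rewrite ip_suml.
have eE i : ip (\sum_j V i j *: e j) (e k) = V i k.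
  rewrite ip_suml (bigD1 k)//= big1 ?addr0 => [|l /negPf lk]; rewrite ipZl oe ?eqxx ?mulr1//.
  by rewrite lk mulr0.
under eq_bigr do rewrite ipZl eE ip_sumr mulr_suml.
rewrite exchange_big /=.
have VtV : V^t* *m V = 1%:M by apply: mulmx1C; exact: unitarymxP.
under eq_bigr => j _.
  under eq_bigr do rewrite ipZr mulrAC mulrC.
  rewrite -mulr_sumr (_ : \sum_i _ = (j == k)%:R); last first.
    have /matrixP/(_ j k) := VtV; rewrite !mxE => <-.
    by apply: eq_bigr => i _; rewrite !mxE.
over.
by rewrite (bigD1 k)//= eqxx mulr1 big1 ?addr0// => j /negPf->; rewrite mulr0.
Qed.

(** In an orthonormal basis where the commuting operators are all triangular, self-adjointness kills
    the entries on the other side of the diagonal as well. *)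
Lemma simultaneous_diagonalization n (e : 'I_n -> H) (S : set (H -> H)) :
  orthonormal_basis ip e ->
  (forall A, S A -> linear A) ->
  (forall A, S A -> forall x y, ip (A x) y = ip x (A y)) ->
  (forall A B, S A -> S B -> A \o B = B \o A) ->
  exists2 f : 'I_n -> H, orthonormal_basis ip f &
    forall A, S A -> forall i, exists a, A (f i) = a *: f i.
Proof.
move=> be Slin Ssa Scomm.
(* [M A] is the transpose of the usual matrix of [A], hence [M] reverses products. *)
pose M (A : H -> H) : 'M[R[i]]_n := \matrix_(i, j) ip (A (e i)) (e j).
have MM A B : linear A -> linear B -> M (A \o B) = M B *m M A.
  move=> Al Bl; apply/matrixP => i j; rewrite !mxE /= {1}(be.2 (B (e i))).
  rewrite (lin_sum Al) ip_suml; apply: eq_bigr => k _.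
  by rewrite (linZ Al) ipZl !mxE.
have [|V Vu Vtrig] := @unitary_cotriangularization _ n [set M A | A in S].
  move=> _ _ [A SA <-] [B SB <-]; rewrite -!MM; [|exact: Slin..].
  by rewrite Scomm.
pose f i := \sum_j V i j *: e j.
have bf : orthonormal_basis ip f by exact: unitary_basis.
exists f => // A SA i; have Al := Slin _ SA.
have entry j k : ip (A (f j)) (f k) = (V *m M A *m V^t*) j k.
  rewrite !mxE /f (lin_sum Al) ip_suml /=.
  under [RHS]eq_bigr do rewrite mxE mulr_suml.
  rewrite exchange_big /=; apply: eq_bigr => l _; rewrite (linZ Al) ip_sumr.
  by apply: eq_bigr => p _; rewrite ipZl ipZr !mxE mulrA mulrAC.
have upper (j k : 'I_n) : (j < k)%N -> ip (A (f j)) (f k) = 0.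
  by rewrite entry; apply/is_trig_mxP/Vtrig; exists A.
exists (ip (A (f i)) (f i)).
rewrite {1}(bf.2 (A (f i))) (bigD1 i)//= big1 ?addr0// => j.
rewrite neq_ltn => /orP[ij|ij]; last by rewrite upper// scale0r.
by rewrite Ssa// ipC upper// rmorph0 scale0r.
Qed.

End SimultaneousDiagonalization.

(** * Finite dimension from a compact invertible operator *)

Section FiniteDimension.
Variables (R : realType) (H : completeNormedModType R[i]).
Variable ip : {dot H for conjC}.
Hypothesis hH : hilbert_norm ip.
Implicit Types (x y z : H) (T A B : H -> H).

(** Distinct orthonormal vectors are at distance [sqrt 2]. *)
Lemma orthonormal_dist n (e : 'I_n -> H) i j :
  orthonormal_family ip e -> `|e i - e j| < 1 -> i = j.
Proof.
move=> oe; case: (eqVneq i j) => // /negPf ij.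
have -> : `|e i - e j| < 1 = (`|e i - e j| ^+ 2 < 1 ^+ 2).
  by rewrite ltr_sqr ?nnegrE.
rewrite hH ipBl !ipBr !oe !eqxx ij eq_sym ij expr1n subr0 sub0r opprK.
by rewrite -[ltRHS]addr0 ltrD2l ltr10.
Qed.

(** Cover the image of the unit ball by finitely many balls of radius [d / 2], with [d] so small
    that the inverse [B] sends vectors of norm below [d] to norm below 1. If [T (e i)] and [T (e j)]
    share a ball, then [e i] and [e j] are at distance less than 1, so [i = j]; thus [n] is at most
    the number of balls. *)
Lemma compact_orthonormal_bound T : compact_op T -> invertible_op T ->
  exists N, forall n (e : 'I_n -> H), orthonormal_family ip e -> (n <= N)%N.
Proof.
case=> -[Tl _] + [B [[Bl Bc] BT _]].
rewrite precompactE compact_cover => Tcov.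
have [d d0 dB] : exists2 d : R[i], 0 < d & forall y, `|y| < d -> `|B y| < 1.
  have := Bc 0; rewrite /continuous_at (lin0 Bl) => B0.
  have /nbhs_ballP[d d0 dB] : \forall y \near (0 : H), `|B y| < 1 by exact: cvgr0_norm_lt.
  by exists d => // y yd; apply: dB; rewrite -ball_normE /= sub0r normrN.
have [|x _|D _ Dcov] := Tcov H setT (fun x : H => ball x (d / 2)).
- by move=> x _; exact: ball_open.
- by exists x => //; apply: ballxx; rewrite divr_gt0.
exists #|{: D}| => n e oe.
have cov i : exists x : D, ball (val x) (d / 2) (T (e i)).
  have [|x /= xD xe] := Dcov (T (e i)).
    apply: subset_closure; exists (e i) => //=.
    have : `|e i| ^+ 2 <= 1 ^+ 2 by rewrite hH oe eqxx expr1n.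
    by rewrite ler_sqr ?nnegrE.
  by exists [` xD]%fset.
have [g ge] := choice cov.
rewrite -[n]card_ord; apply: (@leq_card _ _ g) => i j gij.
apply: (orthonormal_dist oe).
have -> : e i - e j = B (T (e i) - T (e j)).
  by rewrite -(linB Tl) -[RHS]/((B \o T) (e i - e j)) BT.
apply: dB; rewrite (splitr d).
have := ge i; have := ge j; rewrite -gij -!ball_normE /= => hj hi.
rewrite -[T (e i)](subrK (val (g i))) -addrA (le_lt_trans (ler_normD _ _))//.
by rewrite ltrD// distrC.
Qed.

Lemma orthonormal_extend n (e : 'I_n -> H) y : orthonormal_family ip e ->
  y != 0 -> (forall i, ip y (e i) = 0) ->
  exists f : 'I_n.+1 -> H, orthonormal_family ip f.
Proof.
move=> oe y0 ye; pose z := `|y|^-1 *: y.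
have zz : ip z z = 1.
  by rewrite -hH normrZ normfV normr_id mulVf ?expr1n// normr_eq0.
have ze i : ip z (e i) = 0 by rewrite ipZl ye mulr0.
exists (fun i => if unlift ord_max i is Some j then e j else z) => i j.
case: (unliftP ord_max i) => [i' ->|->]; case: (unliftP ord_max j) => [j' ->|->] //.
- by rewrite oe (inj_eq lift_inj).
- by rewrite ipC ze rmorph0 eq_sym (negPf (neq_lift _ _)).
- by rewrite ze (negPf (neq_lift _ _)).
- by rewrite zz eqxx.
Qed.

(** An orthonormal family of maximal size is a basis: a nonzero difference between [x] and its
    expansion would be orthogonal to the family and extend it. *)
Lemma compact_orthonormal_basis T : compact_op T -> invertible_op T ->
  exists n (e : 'I_n -> H), orthonormal_basis ip e.
Proof.
move=> Tc Ti; have [N Nb] := compact_orthonormal_bound Tc Ti.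
pose P n := `[< exists e : 'I_n -> H, orthonormal_family ip e >].
have P0 : exists n, P n.
  by exists 0%N; apply/asboolP; exists (fun=> 0); case.
have PN n : P n -> (n <= N)%N by move=> /asboolP[e /Nb].
case: (ex_maxnP P0 PN) => n /asboolP[e oe] nmax; exists n, e; split=> // x.
apply/eqP; rewrite -subr_eq0; apply/contraT => y0.
have [|f of_] := orthonormal_extend oe y0.
  move=> i; rewrite ipBl ip_suml (bigD1 i)//= big1 ?addr0.
    by rewrite ipZl oe eqxx mulr1 subrr.
  by move=> j /negPf ji; rewrite ipZl oe ji mulr0.
by have := nmax n.+1 (introT (asboolP _) (ex_intro _ f of_)); rewrite ltnn.
Qed.

End FiniteDimension.

(** * Polar decomposition in an eigenbasis *)

Section Polar.
Variables (R : realType) (H : completeNormedModType R[i]).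
Variable ip : {dot H for conjC}.
Hypothesis hH : hilbert_norm ip.
Implicit Types (x y z : H) (T A B U : H -> H).

Lemma conjC_realC (a : R) : conjC (a%:C : R[i]) = a%:C.
Proof. by apply/CrealP/complex_realP; exists a. Qed.

Definition isometric U := forall x y, ip (U x) (U y) = ip x y.

Definition diag_op n (e : 'I_n -> H) (q : 'I_n -> R) :=
  basis_op ip e (fun i => (q i)%:C *: e i).

Section FixedBasis.
Variables (n : nat) (e : 'I_n -> H) (be : orthonormal_basis ip e).
Let oe := be.1.
Implicit Types (q : 'I_n -> R) (i j : 'I_n).

Lemma diag_opE q i : diag_op e q (e i) = (q i)%:C *: e i.
Proof. exact: (basis_opE _ _ oe). Qed.

Lemma diag_linear q : linear (diag_op e q).
Proof. exact: basis_op_linear. Qed.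

Lemma ip_diag q x i : ip (diag_op e q x) (e i) = (q i)%:C * ip x (e i).
Proof.
rewrite ip_suml (bigD1 i)//= big1 ?addr0; first by rewrite !ipZl oe eqxx mulr1 mulrC.
by move=> j /negPf ji; rewrite !ipZl oe ji !mulr0.
Qed.

Lemma diag_selfadjoint q x y : ip (diag_op e q x) y = ip x (diag_op e q y).
Proof.
rewrite !(parseval be); apply: eq_bigr => i _.
by rewrite !ip_diag rmorphM /= conjC_realC mulrCA mulrA.
Qed.

Lemma diag_positive q : (forall i, 0 <= q i) -> positive_op ip (diag_op e q).
Proof.
move=> q0; split; first by apply: (linear_bounded_op hH be); exact: diag_linear.
move=> x; rewrite (parseval be); apply: sumr_ge0 => i _.
rewrite ip_diag -mulrA -normCK; apply: mulr_ge0; last exact: exprn_ge0.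
by rewrite ler0c; exact: q0.
Qed.

Lemma diag_inv q x : (forall i, 0 < q i) ->
  diag_op e q (diag_op e (fun i => (q i)^-1) x) = x.
Proof.
move=> q0; apply: (eq_basis be) => i; rewrite !ip_diag mulrA -rmorphM /=.
by rewrite divff ?gt_eqF// rmorph1 mul1r.
Qed.

Lemma isometric_basis U : linear U -> (forall i j, ip (U (e i)) (U (e j)) = (i == j)%:R) ->
  isometric U.
Proof.
move=> Ul Ue x y; rewrite (parseval be x) {1}(be.2 x) {1}(be.2 y) !(lin_sum Ul).
rewrite ip_suml; apply: eq_bigr => i _; rewrite (linZ Ul) ipZl; congr (_ * _).
rewrite ip_sumr (bigD1 i)//= big1 ?addr0; first by rewrite (linZ Ul) ipZr Ue eqxx mulr1.
by move=> j /negPf ji; rewrite (linZ Ul) ipZr Ue eq_sym ji mulr0.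
Qed.

Lemma adjoint_isometric U x : linear U -> isometric U -> adjoint ip U (U x) = x.
Proof.
by move=> Ul Ui; apply: (@ip_inj _ _ ip) => y; rewrite (ip_adjointl hH be)// Ui.
Qed.

Lemma isometric_inj U : linear U -> isometric U -> injective U.
Proof.
move=> Ul Ui x y xy.
by rewrite -(adjoint_isometric x Ul Ui) xy (adjoint_isometric y Ul Ui).
Qed.

(* [(P + q) (P v - q v) = 0], and [P + q] is injective. *)
Lemma positive_sqrt_eigenvector P v (q : R) : positive_op ip P -> 0 < q ->
  P (P v) = (q ^+ 2)%:C *: v -> P v = q%:C *: v.
Proof.
case=> -[Pl _] Pp q0 PPv; pose w := P v - q%:C *: v.
have Pw : P w = - (q%:C *: w).
  rewrite (linB Pl) (linZ Pl) PPv scalerBr scalerA -rmorphM -expr2 opprB.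
  by [].
have := Pp w; rewrite Pw -scaleNr ipZl => qw.
apply/eqP; rewrite -subr_eq0; apply/eqP/(@ip_eq0 _ _ ip)/eqP.
rewrite eq_le -hH exprn_ge0// andbT hH.
by move: qw; rewrite mulNr oppr_ge0 pmulr_rle0// ltcR.
Qed.

(** [T^* T] is the square of the diagonal operator, so any positive square root acts on [e i] as
    [q i], which determines [abs_op]. As this operator is onto, the equation [T = V |T|] then
    determines the polar part. *)
Lemma polar_isometric_diag U q : linear U -> isometric U -> (forall i, 0 < q i) ->
  let T := U \o diag_op e q in abs_op ip T = diag_op e q /\ polar_part ip T = U.
Proof.
move=> Ul Ui q0 T; have Tl : linear T by apply: linear_comp => //; exact: diag_linear.
set D := diag_op e q.
have TT : adjoint ip T \o T = D \o D.
  apply/funext => x; apply: (@ip_inj _ _ ip) => y /=.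
  by rewrite (ip_adjointl hH be)// Ui [RHS]diag_selfadjoint.
have absT : is_abs_op ip T D.
  by split; [apply: diag_positive => i; exact: ltW (q0 i) | rewrite TT].
have aT : abs_op ip T = D.
  have [Pp PP] : is_abs_op ip T (abs_op ip T).
    exact: (xgetPex (fun=> 0) (ex_intro _ D absT)).
  apply: (eq_linear be); [by case: Pp => -[]|exact: diag_linear|move=> i].
  rewrite /D diag_opE; apply: positive_sqrt_eigenvector => //.
  rewrite -[LHS]/((abs_op ip T \o abs_op ip T) (e i)) PP TT /= /D diag_opE.
  by rewrite (linZ (diag_linear q)) diag_opE scalerA -rmorphM.
split=> //.
have polU : is_polar_part ip T U.
  split; [exact: (linear_bounded_op hH be)| | |by rewrite aT].
    by apply/funext => x /=; rewrite adjoint_isometric.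
  move=> x; split; rewrite -{1}(lin0 Ul) => /(isometric_inj Ul Ui) Dx.
    by rewrite Dx (lin0 Tl).
  suff -> : x = 0 by exact: lin0.
  apply: (eq_basis be) => i.
  have /eqP := ip_diag q x i; rewrite Dx !ip0l eq_sym mulf_eq0 => /orP[|/eqP//].
  by rewrite -(rmorph0 (real_complex R)) (inj_eq (@complexI R)) gt_eqF.
have [_ _ _ TV] : is_polar_part ip T (polar_part ip T).
  exact: (xgetPex (fun=> 0) (ex_intro _ U polU)).
apply/funext => x; rewrite -(diag_inv x q0).
by rewrite -[LHS]/((polar_part ip T \o D) _) -aT -TV.
Qed.

End FixedBasis.

(** An orthonormal eigenbasis of [T^* T] has pairwise orthogonal images under [T], nonzero by
    invertibility. Their norms are the [q i], and [U] sends [e i] to the normalized image. *)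
Lemma polar_exists n (f : 'I_n -> H) T : orthonormal_basis ip f ->
  linear T -> invertible_op T ->
  exists e : 'I_n -> H, exists q U, [/\ orthonormal_basis ip e,
    forall i, 0 < q i, linear U, isometric U & T = U \o diag_op e q].
Proof.
move=> bf Tl [B [[Bl _] BT _]].
have [| | |e be eT] := @simultaneous_diagonalization _ _ ip n f
    [set adjoint ip T \o T] bf.
- by move=> _ ->; apply: linear_comp => //; exact: (adjoint_linear hH bf).
- by move=> _ -> x y /=; rewrite (ip_adjointl hH bf)// (ip_adjoint hH bf).
- by move=> _ _ -> ->.
have oe := be.1.
have Tee i j : i != j -> ip (T (e i)) (T (e j)) = 0.
  move=> ij; have [a /= ae] := eT _ erefl i.
  by rewrite -(ip_adjointl hH bf)// ae ipZl oe (negPf ij) mulr0.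
have Te0 i : T (e i) != 0.
  apply/eqP => Te; have := oe i i; rewrite -[e i]/(id (e i)) -BT /= Te (lin0 Bl).
  by rewrite ip0l eqxx => /esym/eqP; rewrite oner_eq0.
pose q i := complex.Re `|T (e i)|.
have qE i : (q i)%:C = `|T (e i)| by rewrite RRe_real// ger0_real.
have q0 i : 0 < q i by rewrite -ltcR qE normr_gt0.
have qc0 i : (q i)%:C != 0 by rewrite qE normr_eq0.
pose U := basis_op ip e (fun i => ((q i)%:C)^-1 *: T (e i)).
have Ul : linear U by exact: basis_op_linear.
have Ue i : U (e i) = ((q i)%:C)^-1 *: T (e i) by exact: (basis_opE _ _ oe).
exists e, q, U; split=> //.
  apply: (isometric_basis be) => // i j; rewrite !Ue ipZl ipZr.
  case: (eqVneq i j) => [<-|/Tee->]; last by rewrite !mulr0.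
  rewrite -fmorphV conjC_realC -hH -qE expr2 -!rmorphM /=.
  by rewrite mulKf ?mulVf ?gt_eqF.
apply: (eq_linear be) => //; first by apply: linear_comp => //; exact: diag_linear.
by move=> i /=; rewrite diag_opE// (linZ Ul) Ue scalerA divff// scale1r.
Qed.

End Polar.

(** * Spectrum and Riemann sums of a diagonal operator *)

Section FiniteSpectrum.
Variables (R : realType) (H : completeNormedModType R[i]).
Variable ip : {dot H for conjC}.
Hypothesis hH : hilbert_norm ip.
Implicit Types (x y z v : H) (T U : H -> H).

Lemma small_norm_eq x y :
  (forall eps : R, 0 < eps -> `|x - y| <= eps%:C) -> x = y.
Proof.
move=> small; apply/eqP; rewrite -subr_eq0 -normr_eq0.
have nE : `|x - y| = (complex.Re `|x - y|)%:C by rewrite RRe_real// ger0_real.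
rewrite nE -(rmorph0 (real_complex R)) (inj_eq (@complexI R)) eq_le -!lecR -nE.
rewrite rmorph0 normr_ge0 andbT nE -(rmorph0 (real_complex R)) lecR.
by apply/ler_addgt0Pr => eps /small; rewrite add0r nE lecR.
Qed.

Lemma cvg_realC (u : nat -> R) (l : R) :
  u @ \oo --> l ->
  (fun n => (u n)%:C : (R[i] : numFieldType)) @ \oo --> (l%:C : (R[i] : numFieldType)).
Proof.
move=> ul; apply/cvgrPdist_lt => eps eps0.
have eE : eps = (complex.Re eps)%:C by rewrite RRe_real// gtr0_real.
have e0 : 0 < complex.Re eps by rewrite -ltcR -eE.
near=> k.
rewrite -rmorphB /= eE normc_def /= expr0n addr0 sqrtr_sqr ltcR.
by near: k; apply: cvgr_dist_lt.
Unshelve. all: by end_near.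
Qed.

Lemma basis_op_cvg n (e v : 'I_n -> H) (c : nat -> 'I_n -> R) (l : 'I_n -> R) x :
  (forall i, c ^~ i @ \oo --> l i) ->
  (fun k => basis_op ip e (fun i => (c k i)%:C *: v i) x) @ \oo -->
  basis_op ip e (fun i => (l i)%:C *: v i) x.
Proof.
move=> cl; apply: cvg_sum_fin => i; apply: cvgZl_tmp; apply: cvgZr_tmp.
exact: cvg_realC.
Qed.

Let measurable_point (a : R) : measurable ([set a] : set (measurableTypeR R)).
Proof. exact: measurable_set1. Qed.

Lemma sum_pick m (t : 'I_m -> R) k (G : R -> R[i]) :
  injective t -> \sum_l (t k == t l)%:R * G (t l) = G (t k).
Proof.
move=> ti; rewrite (bigD1 k)//= eqxx mul1r big1 ?addr0// => l /negPf lk.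
by rewrite (inj_eq ti) eq_sym lk mul0r.
Qed.

Section FixedBasis.
Variables (n : nat) (e : 'I_n -> H) (be : orthonormal_basis ip e).
Let oe := be.1.
Variables (q : 'I_n -> R).
Let S : set R := range q.

(** Subtracting [s] shifts every diagonal entry: the inverse is diagonal unless some [q i = s], and
    then [e i] is in the kernel. *)
Lemma real_spectrum_diag : real_spectrum (diag_op ip e q) = S.
Proof.
have shift (s : R) x : diag_op ip e q x - s%:C *: x = diag_op ip e (fun i => q i - s) x.
  by apply: (eq_basis be) => i; rewrite ipBl ipZl !(ip_diag be) rmorphB mulrBl.
apply/seteqP; split=> s; rewrite /real_spectrum /spectrum /=.
  apply: contra_notP => sS; have qs i : q i - s != 0.
    by rewrite subr_eq0; apply/eqP => qs; apply: sS; exists i.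
  exists (diag_op ip e (fun i => (q i - s)^-1)); split.
  - by apply: (linear_bounded_op hH be); exact: diag_linear.
  - apply/funext => x /=; rewrite shift; apply: (eq_basis be) => i.
    by rewrite !(ip_diag be) mulrA -rmorphM /= mulVf// mul1r.
  - apply/funext => x /=; rewrite shift; apply: (eq_basis be) => i.
    by rewrite !(ip_diag be) mulrA -rmorphM /= mulfV// mul1r.
move=> [i _ <-] [B [[Bl _] BA _]].
have : e i = 0.
  have := congr1 (fun F : H -> H => F (e i)) BA; rewrite /= shift diag_opE//.
  by rewrite subrr scale0r (lin0 Bl).
move=> ei; have := oe i i; rewrite ei ip0l eqxx => /esym/eqP.
by rewrite oner_eq0.
Qed.

Lemma spectral_gap : exists2 delta : R, 0 < delta &
  forall i j, `|q i - q j| <= delta -> q i = q j.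
Proof.
(* The base value [1] of the minimum keeps [d] positive when all [q i] coincide. *)
pose d := \big[Order.min/1%R]_(p : 'I_n * 'I_n | q p.1 != q p.2) `|q p.1 - q p.2|.
have d0 : 0 < d by apply/bigmin_gtP; split=> // p; rewrite -subr_eq0 normr_gt0.
exists (d / 2); first by rewrite divr_gt0.
move=> i j; apply: contraTeq => qij; rewrite -ltNge.
apply: (@lt_le_trans _ _ d); first by rewrite ltr_pdivrMr// ltr_pMr// ltr1n.
exact: (@bigmin_le_cond _ _ _ _ (i, j)).
Qed.

(** Below the spectral gap a cell contains a single point of the spectrum, so Riemann sums over such
    partitions are exact. *)
Lemma fine_partition : exists2 delta : R, 0 < delta &
  forall m (B : 'I_m -> set (measurableTypeR R)) t, tagged_partition S delta B t ->
  [/\ forall k, B k = [set t k], injective t & forall i, exists k, q i = t k].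
Proof.
have [d d0 dq] := spectral_gap; exists d => // m B t [_ Bd BS Bt Bdiam].
have BSk k a : B k a -> S a by move=> Ba; rewrite -BS; exists k.
have B1 k : B k = [set t k].
  apply/seteqP; split=> a /=; last by move=> ->.
  move=> Ba; have := Bdiam k _ _ Ba (Bt k).
  have [i _ <-] := BSk _ _ Ba; have [j _ <-] := BSk _ _ (Bt k).
  exact: dq.
split=> //.
  by move=> k l kl; apply: Bd => //; exists (t k); rewrite B1 [B l]B1 kl.
move=> i; have : S (q i) by exists i.
by rewrite -BS => -[k _]; rewrite B1 => ->; exists k.
Qed.

(** This partition is admissible for every [delta], so evaluating a limit of Riemann sums on it
    gives an exact identity. *)
Lemma singleton_partition :
  exists m (B : 'I_m -> set (measurableTypeR R)) (t : 'I_m -> R),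
  [/\ forall k, B k = [set t k], injective t, forall i, exists k, q i = t k &
      forall delta, 0 < delta -> tagged_partition S delta B t].
Proof.
pose s := undup [seq q i | i : 'I_n].
pose t (k : 'I_(size s)) : R := s`_k.
have ti : injective t.
  by move=> k l /eqP; rewrite nth_uniq ?undup_uniq// => /eqP/val_inj.
have tq i : exists k, q i = t k.
  have qs : q i \in s by rewrite mem_undup map_f// mem_enum.
  have is_ : (index (q i) s < size s)%N by rewrite index_mem.
  by exists (Ordinal is_); rewrite /t /= nth_index.
have tS k : S (t k).
  have : t k \in s by exact: mem_nth.
  by rewrite mem_undup => /mapP[i _ ->]; exists i.
exists (size s), (fun k => [set t k]), t; split=> // delta d0; split=> //.
- by move=> k l _ _ [a [/= -> /ti]].
- apply/seteqP; split=> a; first by move=> [k _ ->].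
  by move=> [i _ <-]; have [k ->] := tq i; exists k.
- by move=> k a b /= -> ->; rewrite subrr normr0 ltW.
Qed.

Definition eigenproj (a : R) := diag_op ip e (fun i => (q i == a)%:R).

Lemma ip_eigenproj a x i : ip (eigenproj a x) (e i) = (q i == a)%:R * ip x (e i).
Proof. by rewrite (ip_diag be) rmorph_nat. Qed.

Lemma sum_eigenproj m (t : 'I_m -> R) (phi : R -> R) x :
  injective t -> (forall i, exists k, q i = t k) ->
  \sum_k (phi (t k))%:C *: eigenproj (t k) x = diag_op ip e (phi \o q) x.
Proof.
move=> ti tq; apply: (eq_basis be) => i; rewrite ip_suml (ip_diag be) /=.
have [k ki] := tq i; rewrite ki -(@sum_pick _ t k (fun a => (phi a)%:C * _))//.
by apply: eq_bigr => l _; rewrite ipZl ip_eigenproj ki mulrCA.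
Qed.

(** Schur product: each matrix entry of [U] is multiplied by the value of [phi] at the corresponding
    pair of eigenvalues. *)
Definition schur_op (phi : R -> R -> R) U :=
  basis_op ip e (fun j => \sum_i ((phi (q i) (q j))%:C * ip (U (e j)) (e i)) *: e i).

(** In row [i] and column [j] only the tags [s k = q i] and [t l = q j] contribute, which leaves
    [phi (q i) (q j)]. *)
Lemma double_sum_eigenproj m (s : 'I_m -> R) p (t : 'I_p -> R) (phi : R -> R -> R) U x :
  linear U ->
  injective s -> (forall i, exists k, q i = s k) ->
  injective t -> (forall i, exists k, q i = t k) ->
  \sum_k \sum_l (phi (s k) (t l))%:C *: eigenproj (s k) (U (eigenproj (t l) x)) =
  schur_op phi U x.
Proof.
move=> Ul si sq ti tq; apply: (eq_basis be) => i; rewrite ip_suml.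
transitivity (\sum_j ip x (e j) * ((phi (q i) (q j))%:C * ip (U (e j)) (e i))); last first.
  rewrite ip_suml; apply: eq_bigr => j _; rewrite ipZl ip_suml (bigD1 i)//= big1 ?addr0.
    by rewrite ipZl oe eqxx mulr1.
  by move=> l /negPf li; rewrite ipZl oe li mulr0.
have [k ki] := sq i; rewrite ki.
rewrite -(@sum_pick _ s k (fun a => \sum_j ip x (e j) * ((phi a (q j))%:C * _)))//.
apply: eq_bigr => k' _; rewrite ip_suml.
under eq_bigr do rewrite ipZl ip_eigenproj ki mulrCA.
rewrite -mulr_sumr; congr (_ * _).
have UE y : ip (U y) (e i) = \sum_j ip y (e j) * ip (U (e j)) (e i).
  rewrite {1}(be.2 y) (lin_sum Ul) ip_suml.
  by apply: eq_bigr => j _; rewrite (linZ Ul) ipZl.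
under eq_bigr do rewrite UE mulr_sumr.
rewrite exchange_big /=; apply: eq_bigr => j _.
have [l lj] := tq j; rewrite lj.
rewrite -(@sum_pick _ t l (fun a => ip x (e j) * ((phi (s k') a)%:C * _)))//.
by apply: eq_bigr => l' _; rewrite ip_eigenproj lj -mulrA mulrCA [_%:C * _]mulrCA.
Qed.

End FixedBasis.

(** * Existence and uniqueness of the spectral measure *)

Section SpectralMeasure.
Variables (n : nat) (e : 'I_n -> H) (be : orthonormal_basis ip e).
Let oe := be.1.
Variables (q : 'I_n -> R) (q0 : forall i, 0 < q i).
Let S : set R := range q.
Let A := diag_op ip e q.

Definition diag_measure (B : set (measurableTypeR R)) : H -> H :=
  diag_op ip e (fun i => (q i \in B)%:R).

Lemma diag_measure1 a : diag_measure [set a] = eigenproj e q a.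
Proof.
congr basis_op; apply/funext => i; congr ((_ : bool)%:R%:C *: _).
by apply/idP/eqP => [/set_mem|->]; last exact/mem_set.
Qed.

Lemma diag_measure_spectral : spectral_measure ip diag_measure.
Proof.
have ipE B x i : ip (diag_measure B x) (e i) = (q i \in B)%:R * ip x (e i).
  by rewrite (ip_diag be) rmorph_nat.
have ET : diag_measure setT = id.
  by apply/funext => x; apply: (eq_basis be) => i; rewrite ipE in_setT mul1r.
have EI B C : diag_measure (B `&` C) = diag_measure B \o diag_measure C.
  apply/funext => x; apply: (eq_basis be) => i /=.
  by rewrite !ipE in_setI mulrA -natrM mulnb.
split=> // [B _|F _ Fd x].
  split; [|by rewrite -EI setIid|exact: (diag_selfadjoint be)].
  by apply: (linear_bounded_op hH be); exact: diag_linear.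
(* The partial sums are diagonal; by disjointness at most one [F j] contains [q i], so each diagonal
   entry is eventually constant. *)
rewrite (_ : (fun k => _) =
    (fun k => diag_op ip e (fun i => \sum_(j < k) (q i \in F j)%:R) x)); last first.
  apply/funext => k; apply: (eq_basis be) => i; rewrite ip_suml (ip_diag be).
  by rewrite rmorph_sum mulr_suml; apply: eq_bigr => j _; rewrite ipE rmorph_nat.
apply: basis_op_cvg => i; apply: cvg_near_cst.
case: (boolP (q i \in \bigcup_k F k)) => [|qF].
  move=> /set_mem[j _ Fj]; near=> k.
  have jk : (j < k)%N by near: k; exact: nbhs_infty_gt.
  rewrite (bigD1 (Ordinal jk))//= mem_set// big1 ?addr0// => l lj.
  rewrite memNset// => Fl; move/eqP: lj; apply; apply: val_inj => /=.
  by apply: Fd => //; exists (q i).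
near=> k; rewrite big1// => j _; rewrite memNset// => Fj.
by move/negP: qF; apply; apply/mem_set; exists j.
Unshelve. all: by end_near.
Qed.

Lemma diag_measure_decomposition : spectral_decomposition ip A diag_measure.
Proof.
rewrite /spectral_decomposition (real_spectrum_diag be).
split; first exact: diag_measure_spectral.
  apply/funext => x; apply: (eq_basis be) => i.
  by rewrite (ip_diag be) mem_set ?rmorph1 ?mul1r//; exists i.
move=> x eps eps0; have [d d0 fine] := fine_partition q.
exists d => // m B t /fine[B1 ti tq].
under eq_bigr do rewrite B1 diag_measure1.
by rewrite (sum_eigenproj be id x ti tq) subrr normr0 lecR ltW.
Qed.

Section UniqueMeasure.
Variables (E : set (measurableTypeR R) -> H -> H) (EA : spectral_decomposition ip A E).

Let E_ortho B : measurable B -> orthogonal_projection ip (E B).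
Proof. by case: EA => -[+ _ _ _] _ _; apply. Qed.

Let EI B C : measurable B -> measurable C -> E (B `&` C) = E B \o E C.
Proof. by case: EA => -[_ _ + _] _ _; apply. Qed.

(** For the constant sequence of empty sets the partial sums converge, so their increments, all
    equal to [E set0 x], tend to 0. *)
Lemma spectral_measure_set0 x : E set0 x = 0.
Proof.
case: EA => -[_ _ _ /(_ (fun=> set0) (fun=> measurable0))] + _ _.
have td : trivIset [set: nat] (fun=> set0 : set (measurableTypeR R)).
  by move=> i j _ _ [a []].
move=> /(_ td x); rewrite bigcup0// => Ec.
pose F k : H := \sum_(j < k) E set0 x.
have {}Ec : F @ \oo --> E set0 x by [].
have E1 : (fun k => F (k + 1)%N - F k) @ \oo --> (0 : H).
  by rewrite -[0](subrr (E set0 x)); apply: cvgB => //; rewrite (cvg_shiftn 1 F).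
rewrite (_ : (fun k => _) = (fun=> E set0 x)) in E1; last first.
  by apply/funext => k; rewrite /F addn1 big_ord_recr /= addrAC subrr add0r.
apply: (cvg_unique (@norm_hausdorff _ H) _ E1); exact: cvg_cst.
Qed.

Lemma spectral_sum m (B : 'I_m -> set (measurableTypeR R)) (t : 'I_m -> R) x :
  (forall k, B k = [set t k]) ->
  (forall delta, 0 < delta -> tagged_partition S delta B t) ->
  A x = \sum_k (t k)%:C *: E [set t k] x.
Proof.
move=> B1 Bp; apply: small_norm_eq => eps eps0.
case: EA => _ _ /(_ x eps eps0); rewrite (real_spectrum_diag be) => -[d d0].
by move=> /(_ m B t (Bp d d0)); under eq_bigr do rewrite B1.
Qed.

(** Atoms at distinct eigenvalues have product zero, so the range of [E [set t k]] lies in the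
    eigenspace of [t k]. By self-adjointness this projection kills every [e j] with another
    eigenvalue. If [q j = t k], the expansion of [A (e j)] reduces to [t k] times [E [set t k] (e
    j)], and dividing by [t k > 0] gives [e j]. *)
Lemma spectral_measure1 i : E [set q i] = eigenproj e q (q i).
Proof.
have [m [B [t [B1 ti tq Bp]]]] := singleton_partition q.
have Asum x := spectral_sum x B1 Bp.
have m1 := measurable_point.
have Et k x : A (E [set t k] x) = (t k)%:C *: E [set t k] x.
  rewrite Asum (bigD1 k)//= big1 ?addr0.
    by rewrite -[E _ (E _ _)]/((E [set t k] \o E [set t k]) x) -EI// setIid.
  move=> l lk; rewrite -[E _ (E _ _)]/((E [set t l] \o E [set t k]) x) -EI//.
  rewrite (_ : _ `&` _ = set0) ?spectral_measure_set0 ?scaler0//.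
  by apply/seteqP; split=> // a [/= -> /ti/eqP]; rewrite (negPf lk).
have Esa k x y : ip (E [set t k] x) y = ip x (E [set t k] y).
  by have [_ _ ->] := E_ortho (m1 (t k)).
have E0 k x j : q j != t k -> ip (E [set t k] x) (e j) = 0.
  move=> qt; have := ip_diag be q (E [set t k] x) j.
  rewrite -/A Et ipZl => /eqP; rewrite -subr_eq0 -mulrBl mulf_eq0 -rmorphB.
  rewrite -(rmorph0 (real_complex R)) (inj_eq (@complexI R)) subr_eq0 eq_sym (negPf qt).
  by rewrite rmorph0 => /eqP.
have E0l k j : q j != t k -> E [set t k] (e j) = 0.
  move=> qt; apply: (@ip_inj _ _ ip) => y.
  by rewrite Esa ipC E0// rmorph0 ip0l.
have E1 k j : q j = t k -> E [set t k] (e j) = e j.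
  move=> qt; have := Asum (e j); rewrite /A diag_opE// (bigD1 k)//= big1 ?addr0.
    have tk0 : (t k)%:C != 0 :> R[i].
      by rewrite -(rmorph0 (real_complex R)) (inj_eq (@complexI R)) -qt gt_eqF.
    by rewrite qt => /(scalerI tk0).
  by move=> l lk; rewrite E0l ?scaler0// qt (inj_eq ti) eq_sym.
have [k ->] := tq i.
apply: (eq_linear be); [by have [[]] := E_ortho (m1 (t k))|exact: diag_linear|].
move=> j; rewrite /eigenproj diag_opE//; case: (eqVneq (q j) (t k)) => [/E1->|/E0l->].
  by rewrite scale1r.
by rewrite scale0r.
Qed.

End UniqueMeasure.
End SpectralMeasure.

(** The explicit spectral measure shows that a transform exists. For uniqueness, whichever measure
    accompanies the chosen transform has the eigenprojections as atoms, and the singleton partition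
    turns its double integral into the same Schur product. *)
Lemma Aluthge_isometric_diag n (e : 'I_n -> H) (q : 'I_n -> R) U (f : R -> R) :
  orthonormal_basis ip e -> (forall i, 0 < q i) -> linear U -> isometric ip U ->
  Aluthge ip f (U \o diag_op ip e q) =
  schur_op e q (fun s t => s * f (t / s)) U.
Proof.
move=> be q0 Ul Ui; set T := U \o _; set D := schur_op _ _ _ _.
have [aT pT] := polar_isometric_diag hH be Ul Ui q0.
have Dp : is_Aluthge ip f T D.
  split; first by apply: (linear_bounded_op hH be); exact: basis_op_linear.
  exists (diag_measure e q); rewrite aT; first exact: diag_measure_decomposition.
  rewrite pT (real_spectrum_diag be) => x eps eps0.
  have [d d0 fine] := fine_partition q.
  exists d => // m B s p C t /fine[B1 si sq] /fine[C1 ti tq].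
  under eq_bigr do under eq_bigr do rewrite B1 C1 !diag_measure1.
  rewrite (double_sum_eigenproj be (fun s t => s * f (t / s)) x Ul si sq ti tq).
  by rewrite subrr normr0 lecR ltW.
have [_ [E ET]] : is_Aluthge ip f T (Aluthge ip f T).
  exact: (xgetPex (fun=> 0) (ex_intro _ D Dp)).
rewrite aT in ET *; rewrite pT (real_spectrum_diag be) => Eint.
have [m [B [t [B1 ti tq Bp]]]] := singleton_partition q.
apply/funext => x; apply: small_norm_eq => eps eps0.
have [d d0 /(_ m B t m B t (Bp d d0) (Bp d d0))] := Eint x eps eps0.
have E1 k : E [set t k] = eigenproj e q (t k).
  have : range q (t k) by case: (Bp _ d0) => _ _ <- Bt _; exists k.
  by move=> [i _ <-]; exact: (spectral_measure1 be).
under eq_bigr do under eq_bigr do rewrite !B1 !E1.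
by rewrite (double_sum_eigenproj be (fun s t => s * f (t / s)) x Ul ti tq ti tq).
Qed.

End FiniteSpectrum.

(** * Lazy averages along a permutation *)

Section PermutationAverages.
Variables (R : realType) (n : nat) (s : {perm 'I_n}).
Implicit Types (l : R) (h : 'I_n -> R).

Definition lazy_step l h : 'I_n -> R := fun j => (1 - l) * h (s j) + l * h j.

(** The sum runs over the order of [s], a multiple of every orbit length, so this is the mean of [h]
    over the orbit of [j]. *)
Definition orbit_mean h : 'I_n -> R :=
  fun j => #[s]%g%:R^-1 * \sum_(k < #[s]%g) h (iter k s j).

Lemma iter_lazy_step_gt0 l h : 0 < l < 1 -> (forall j, 0 < h j) ->
  forall k j, 0 < iter k (lazy_step l) h j.
Proof.
move=> /andP[l0 l1] h0; elim=> [//|k IH] j; rewrite iterS.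
by rewrite addr_gt0// mulr_gt0// subr_gt0.
Qed.

Lemma orbit_mean_gt0 h : (forall j, 0 < h j) -> forall j, 0 < orbit_mean h j.
Proof.
move=> h0 j; rewrite mulr_gt0 ?invr_gt0 ?ltr0n ?order_gt0//.
case: #[s]%g (order_gt0 s) => // k _; rewrite big_ord_recl ltr_wpDr//.
by apply: sumr_ge0 => i _; exact: ltW.
Qed.

(** Sum of the pointwise identity [((1 - l) a + l b)^2 = (1 - l) a^2 + l b^2 - l (1 - l) (b - a)^2];
    reindexing by [s] preserves the sum of squares. *)
Lemma lazy_step_sumsq l h : \sum_j lazy_step l h j ^+ 2 =
  \sum_j h j ^+ 2 - l * (1 - l) * \sum_j (h j - h (s j)) ^+ 2.
Proof.
have -> : \sum_j h j ^+ 2 = (1 - l) * \sum_j h (s j) ^+ 2 + l * \sum_j h j ^+ 2.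
  rewrite [in LHS](reindex_inj (@perm_inj _ s)) [in X in l * X](reindex_inj (@perm_inj _ s)) /=.
  by rewrite -mulrDl subrK mul1r.
rewrite !mulr_sumr -big_split -sumrB /=; apply: eq_bigr => j _; rewrite /lazy_step.
ring.
Qed.

(* The sum of squares decreases by [l (1 - l)] times the sum of the squared
   differences, hence the differences are square summable in time. *)
Lemma lazy_step_diff_cvg l h j : 0 < l < 1 ->
  (fun k => iter k (lazy_step l) h j - iter k (lazy_step l) h (s j)) @ \oo --> (0 : R).
Proof.
move=> /andP[l0 l1]; have ll0 : 0 < l * (1 - l) by rewrite mulr_gt0 ?subr_gt0.
pose V k := \sum_j iter k (lazy_step l) h j ^+ 2.
pose d k j := iter k (lazy_step l) h j - iter k (lazy_step l) h (s j).
have VS k : V k - V k.+1 = l * (1 - l) * \sum_j d k j ^+ 2.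
  by rewrite /V iterS lazy_step_sumsq opprB addrC subrK.
have d_ge0 k : 0 <= \sum_j d k j ^+ 2 by apply: sumr_ge0 => i _; exact: sqr_ge0.
have Vcvg : cvgn V.
  apply: nonincreasing_is_cvgn.
    by apply/nonincreasing_seqP => k; rewrite -subr_ge0 VS mulr_ge0// ltW.
  by exists 0 => _ [k _ <-]; apply: sumr_ge0 => i _; exact: sqr_ge0.
have V0 : (fun k => V k - V k.+1) @ \oo --> (0 : R).
  rewrite -(subrr (limn V)); apply: cvgB => //.
  by have := Vcvg; rewrite -(cvg_shiftS V).
apply/cvgr0Pnorm_lt => eps eps0.
have e2 : 0 < l * (1 - l) * eps ^+ 2 by rewrite mulr_gt0// exprn_gt0.
move/cvgr0Pnorm_lt: V0 => /(_ _ e2); apply: filterS => k.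
rewrite VS (ger0_norm (mulr_ge0 (ltW ll0) (d_ge0 k))) ltr_pM2l// => dk.
rewrite -/(d k j) -ltr_sqr ?nnegrE ?normr_ge0 ?(ltW eps0)// -normrX ger0_norm ?sqr_ge0//.
apply: le_lt_trans dk; rewrite (bigD1 j)//= lerDl.
by apply: sumr_ge0 => i _; exact: sqr_ge0.
Qed.

(* [h] differs from its orbit mean by a coboundary [Y - Y \o s], whose lazy
   averages tend to 0; the mean itself is fixed by the averaging. *)
Lemma lazy_step_cvg l h j : 0 < l < 1 ->
  iter k (lazy_step l) h j @[k --> \oo] --> orbit_mean h j.
Proof.
move=> l01; set N := #[s]%g; set F := orbit_mean h.
have N0 : N%:R != 0 :> R by rewrite pnatr_eq0 -lt0n order_gt0.
(* [Y] averages the partial sums [S_k = \sum_(m < k) h \o s^m] over [k < N]. Since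
   [S_k - S_k \o s = h - h \o s^k], this gives [Y - Y \o s = h - F]. *)
pose Y i := N%:R^-1 * \sum_(k < N) \sum_(m < k) h (iter m s i).
have Fs i : F (s i) = F i.
  congr (_ * _); apply/eqP; rewrite -subr_eq0 -sumrB -(big_mkord xpredT
    (fun k => h (iter k s (s i)) - h (iter k s i))).
  rewrite (@telescope_sumr_eq R _ _ (fun k => h (iter k s i)))//.
    by rewrite -permX expg_order perm1 subrr.
  by move=> k _; rewrite -iterSr.
have hE i : h i = F i + (Y i - Y (s i)).
  rewrite -mulrBr -mulrDr -sumrB -big_split /=.
  rewrite (eq_bigr (fun=> h i)) ?sumr_const ?card_ord ?mulrA ?mulKf//.
    by rewrite -[h i *+ _]mulr_natl mulKf.
  move=> k _; rewrite -sumrB -(big_mkord xpredT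
    (fun m => h (iter m s i) - h (iter m s (s i)))).
  rewrite (@telescope_sumr_eq R _ _ (fun m => - h (iter m s i)))//.
    by rewrite /= opprK addrA subrr add0r.
  by move=> m _; rewrite -iterSr opprK addrC.
have iterE k i : iter k (lazy_step l) h i =
    F i + (iter k (lazy_step l) Y i - iter k (lazy_step l) Y (s i)).
  elim: k i => [|k IH] i; first exact: hE.
  by rewrite !iterS /lazy_step !IH Fs; ring.
under eq_fun do rewrite iterE.
have := cvgD (cvg_cst (F j)) (lazy_step_diff_cvg Y j l01); rewrite addr0.
by apply; exact: eventually_filter.
Qed.

End PermutationAverages.

(** * Power means in terms of [r]-th powers *)

Section PowerMean.
Variable R : realType.

(** With [a = x^r] and [b = y^r], the kernel [x f(y / x)] is the [1/r] power of a weighted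
    arithmetic mean, which makes the iteration linear in the [r]-th powers. *)
Lemma power_mean_homogeneous (r l a b : R) : r != 0 -> 0 < l < 1 -> 0 < a -> 0 < b ->
  a `^ r^-1 * power_mean r l (b `^ r^-1 / a `^ r^-1) = ((1 - l) * a + l * b) `^ r^-1.
Proof.
move=> r0 /andP[l0 l1] a0 b0; have ba : 0 < b / a by rewrite divr_gt0.
have -> : b `^ r^-1 / a `^ r^-1 = (b / a) `^ r^-1.
  rewrite -{1}[b](@divfK _ a) ?gt_eqF// (@powRM _ (b / a) a) ?ltW// mulfK//.
  by rewrite gt_eqF// powR_gt0.
have c0 : 0 < 1 - l + l * (b / a) by rewrite addr_gt0 ?subr_gt0// mulr_gt0.
rewrite /power_mean -powRrM mulVf// powRr1 ?ltW// -powRM ?ltW//.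
by congr (_ `^ _); field; rewrite gt_eqF.
Qed.

Lemma powR_cvg (u : nat -> R) (a p : R) : (forall k, 0 < u k) -> 0 < a ->
  u @ \oo --> a -> u k `^ p @[k --> \oo] --> a `^ p.
Proof.
move=> u0 a0 ua; rewrite /powR (gt_eqF a0).
under eq_fun => k do rewrite (gt_eqF (u0 k)).
have lnu : p * ln (u k) @[k --> \oo] --> p * ln a.
  by apply: cvgMr; exact: (cvg_comp _ _ ua (continuous_ln a0)).
exact: (cvg_comp _ _ lnu (@continuous_expR R _)).
Qed.

End PowerMean.

(** Some term of the Leibniz formula is nonzero. Its permutation is indexed by rows, hence the
    inverse, which is indexed by columns. *)
Lemma unitmx_perm (F : fieldType) n (M : 'M[F]_n) : M \in unitmx ->
  exists s : {perm 'I_n}, forall j, M (s j) j != 0.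
Proof.
rewrite unitmxE unitfE => /eqP det0.
have [s Ms] : exists s : {perm 'I_n}, \prod_i M i (s i) != 0.
  apply: contra_notP det0 => noS; rewrite /determinant big1// => s _.
  case: (eqVneq (\prod_i M i (s i)) 0) => [->|Ms]; first by rewrite mulr0.
  by exfalso; apply: noS; exists s.
exists (s^-1)%g => j; move/prodf_neq0: Ms => /(_ (s^-1 j)%g isT).
by rewrite permKV.
Qed.

(** * Iterates of the induced Aluthge transformation *)

Section Iteration.
Variables (R : realType) (H : completeNormedModType R[i]).
Variable ip : {dot H for conjC}.
Hypothesis hH : hilbert_norm ip.
Variables (n : nat) (e : 'I_n -> H) (be : orthonormal_basis ip e).
Let oe := be.1.
Variables (U : H -> H) (Ul : linear U) (Ui : isometric ip U).
Variable s : {perm 'I_n}.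
Implicit Types (q h : 'I_n -> R).

(* For [P_k := diag_op e (h \o s^k)] this says [U^* P_k U = P_(k+1)]. *)
Definition shift_compatible h := forall k i j,
  ip (U (e j)) (e i) != 0 -> h (iter k s i) = h (iter k.+1 s j).

(** A nonzero entry of [U] in row [i] and column [j] forces [q i = q (s j)]. The Schur multiplier
    therefore depends on [j] alone and acts as a diagonal factor on the right of [U]. *)
Lemma Aluthge_step (f : R -> R) q : (forall i, 0 < q i) -> shift_compatible q ->
  Aluthge ip f (U \o diag_op ip e q) =
  U \o diag_op ip e (fun j => q (s j) * f (q j / q (s j))).
Proof.
move=> q0 qs; rewrite (Aluthge_isometric_diag hH f be q0 Ul Ui).
apply: (eq_linear be); first exact: basis_op_linear.
  by apply: linear_comp => //; exact: diag_linear.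
move=> j /=; rewrite /schur_op (basis_opE _ _ oe) diag_opE// (linZ Ul).
rewrite {2}(be.2 (U (e j))) scaler_sumr; apply: eq_bigr => i _.
rewrite scalerA; case: (eqVneq (ip (U (e j)) (e i)) 0) => [->|uij].
  by rewrite !mulr0.
by rewrite (qs 0%N i j uij).
Qed.

(** The conditions on [h] for [k] and [k.+1] combine into the new condition for [k]; this is why
    [shift_compatible] ranges over all iterates of [s]. *)
Lemma shift_compatible_lazy_step l h :
  shift_compatible h -> shift_compatible (lazy_step s l h).
Proof.
by move=> hs k i j uij; rewrite /lazy_step -!iterS !(hs _ _ _ uij).
Qed.

Lemma Aluthge_iter r l h k : r != 0 -> 0 < l < 1 ->
  (forall i, 0 < h i) -> shift_compatible h ->
  iter k (Aluthge ip (power_mean r l)) (U \o diag_op ip e (fun i => h i `^ r^-1)) =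
  U \o diag_op ip e (fun i => iter k (lazy_step s l) h i `^ r^-1).
Proof.
move=> r0 l01 h0 hs; elim: k => [//|k IH]; rewrite iterS {}IH.
have hk0 := iter_lazy_step_gt0 s l01 h0 k.
have hks : shift_compatible (iter k (lazy_step s l) h).
  by elim: (k) => [//|m IH]; exact: shift_compatible_lazy_step.
rewrite Aluthge_step.
- congr (_ \o diag_op _ _ _); apply/funext => j.
  by rewrite power_mean_homogeneous.
- by move=> i; rewrite powR_gt0.
- by move=> m i j uij; rewrite (hks m i j uij).
Qed.

End Iteration.

(** * Canonical form of a centered operator *)

Section Centered.
Variables (R : realType) (H : completeNormedModType R[i]).
Variable ip : {dot H for conjC}.
Hypothesis hH : hilbert_norm ip.
Variables (T : H -> H) (Tl : linear T) (Tinv : invertible_op T) (Tc : centered ip T).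

(** Being centered makes the operators [A m], the conjugates of [|T|] by powers of [U], commute. The
    basis [e] is a common eigenbasis for them, chosen anew after the eigenbasis [e0] that yields the
    polar decomposition. *)
Lemma centered_canonical_form n (f : 'I_n -> H) : orthonormal_basis ip f ->
  exists (e : 'I_n -> H) U (q : 'I_n -> R) (s : {perm 'I_n}),
  [/\ orthonormal_basis ip e, linear U /\ isometric ip U, forall i, 0 < q i,
      shift_compatible ip e U s q & T = U \o diag_op ip e q].
Proof.
move=> bf; have [e0 [q0 [U [be0 q0_gt0 Ul Ui TE]]]] := polar_exists hH bf Tl Tinv.
set P := diag_op ip e0 q0 in TE; pose Us := adjoint ip U.
have [aT pT] := polar_isometric_diag hH be0 Ul Ui q0_gt0.
rewrite -/P -TE in aT pT.
have Pl : linear P by exact: diag_linear.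
have Psa := diag_selfadjoint be0 q0 : forall x y, ip (P x) y = ip x (P y).
have [_ Pp] : positive_op ip P by apply: (diag_positive hH be0) => i; exact: ltW.
have Usl : linear Us by exact: (adjoint_linear hH bf).
have UsU x : Us (U x) = x by exact: (adjoint_isometric hH bf).
(* Surjectivity of [U] comes from the right inverse [B] of [T]. *)
have UUs x : U (Us x) = x.
  have [B [_ _ TB]] := Tinv.
  have -> : x = U (P (B x)) by rewrite -[RHS]/((U \o P \o B) x) -TE TB.
  by rewrite UsU.
pose A m := iter m Us \o P \o iter m U.
have AS m x : U (A m.+1 x) = A m (U x) by rewrite /A /= UUs -iterSr.
have ipUs m x y : ip (iter m Us x) y = ip x (iter m U y).
  by elim: m y => [//|m IH] y; rewrite iterS (ip_adjointl hH bf)// IH -iterSr.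
have Al m : linear (A m).
  exact: (linear_comp (linear_comp (linear_iter m Usl) Pl) (linear_iter m Ul)).
have Asa m x y : ip (A m x) y = ip x (A m y).
  by rewrite ipUs Psa ipC -ipUs -ipC.
have Ap m x : 0 <= ip (A m x) x by rewrite ipUs; exact: Pp.
have AT m : centered_family ip T (A m).
  (* The index 0 gives [|T|] itself, which [centered_family] lists separately. *)
  rewrite /centered_family aT pT; case: m => [|m]; first by apply: Or32.
  by apply: Or31; exists m.+1.
have [| | |e be eA] := @simultaneous_diagonalization _ _ ip n f (range A) bf.
- by move=> _ [m _ <-].
- by move=> _ [m _ <-].
- by move=> _ _ [m _ <-] [p _ <-]; exact: Tc.
have oe := be.1; pose g m i := complex.Re (ip (A m (e i)) (e i)).
have gE m i : A m (e i) = (g m i)%:C *: e i.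
  have [a ae] := eA (A m) (ex_intro2 _ _ m I erefl) i.
  rewrite /g RRe_real ?ger0_real//.
  by rewrite ae ipZl oe eqxx mulr1.
have gE' m i : ip (A m (e i)) (e i) = (g m i)%:C by rewrite gE ipZl oe eqxx mulr1.
have g0 i : 0 < g 0%N i.
  have g_ge0 : 0 <= g 0%N i by rewrite -ler0c -gE'.
  rewrite lt_def g_ge0 andbT; apply/eqP => gi0.
  have Pei : P (e i) = 0 by have := gE 0%N i; rewrite gi0 scale0r.
  have [B [[Bl _] BT _]] := Tinv.
  have ei : e i = 0.
    by rewrite -[LHS]/(id (e i)) -BT /= TE /= Pei (lin0 Ul) (lin0 Bl).
  by have := oe i i; rewrite ei ip0l eqxx => /esym/eqP; rewrite oner_eq0.
(* Evaluate [ip (U (A m.+1 (e j))) (e i)] in two ways: [A m.+1] has eigenvalue [g m.+1 j] at [e j],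
   and moving [U] inside gives [A m], whose eigenvalue at [e i] is [g m i]. *)
have gS m i j : ip (U (e j)) (e i) != 0 -> g m i = g m.+1 j.
  move=> uij; apply: (@complexI R); apply: (mulIf uij).
  by rewrite -[RHS]ipZl -(linZ Ul) -gE AS Asa gE ipZr conjC_realC.
pose M := \matrix_(i < n, j < n) ip (U (e j)) (e i).
(* [M] is the matrix of [U]; it is invertible because its columns are orthonormal. *)
have [|s sM] := @unitmx_perm _ n M.
  have MM : M^t* *m M = 1%:M.
    apply/matrixP => i j; rewrite !mxE eq_sym -(oe j i) -(Ui (e j)) (parseval be).
    by apply: eq_bigr => k _; rewrite !mxE mulrC.
  by have [] := mulmx1_unit MM.
(* At the nonzero entries [(s i, i)] the relation [gS] reads [g m (s i) = g m.+1 i]; iterating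
   reduces all eigenvalues to those of [|T|]. *)
have gs m i : g m i = g 0%N (iter m s i).
  elim: m i => [//|m IH] i; rewrite iterSr -IH; apply/esym/gS.
  by have := sM i; rewrite mxE.
exists e, U, (g 0%N), s; split=> //.
  by move=> k i j uij; rewrite -!gs; exact: gS.
rewrite {1}TE; congr (_ \o _); apply: (eq_linear be) => //; first exact: diag_linear.
by move=> i; rewrite diag_opE// -gE.
Qed.

End Centered.

(** * Existence of the limit and its independence of [lambda] *)

Unset Implicit Arguments.

Theorem theorem6p3 (R : realType) (H : completeNormedModType R[i])
    (ip : {dot H for conjC}) (hH : hilbert_norm ip)
    (r : R) (hr : -1 <= r <= 1) (hr0 : r != 0)
    (T : H -> H) (hT : bounded_op T) (hTinv : invertible_op T)
    (hTc : centered ip T)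
    (hTK : compact_op T \/ exists n : nat, is_Cn ip n) :
  exists L : H -> H, forall lambda : R, 0 < lambda < 1 ->
    strong_cvg (fun n => iter n (Aluthge ip (power_mean r lambda)) T) L.
Proof.
have [n [f bf]] : exists n (f : 'I_n -> H), orthonormal_basis ip f.
  by case: hTK => [hK|[n [f [of_ bf]]]]; [exact: compact_orthonormal_basis hK hTinv|exists n, f].
have [e [U [q [s [be [Ul Ui] q0 qs TE]]]]] :=
  centered_canonical_form hH hT.1 hTinv hTc bf.
pose h i := q i `^ r.
have h0 i : 0 < h i by rewrite powR_gt0.
have hs : shift_compatible ip e U s h.
  by move=> k i j uij; rewrite /h (qs k i j uij).
have qE : q = fun i => h i `^ r^-1.
  by apply/funext => i; rewrite /h -powRrM divff// powRr1// ltW.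
(* The limit is [U] times the diagonal operator of the [1/r] powers of the orbit means of [h]; it is
   given before [lambda] is introduced. *)
exists (basis_op ip e (fun j => (orbit_mean s h j `^ r^-1)%:C *: U (e j))).
move=> l l01; split; first exact: (basis_op_bounded hH _ be.1).
move=> x.
have iterE k : iter k (Aluthge ip (power_mean r l)) T x =
    basis_op ip e (fun j => (iter k (lazy_step s l) h j `^ r^-1)%:C *: U (e j)) x.
  rewrite TE qE (Aluthge_iter hH be Ul Ui k hr0 l01 h0 hs) /= (lin_sum Ul).
  by apply: eq_bigr => j _; rewrite !(linZ Ul).
under eq_fun do rewrite iterE.
apply: basis_op_cvg => j; apply: powR_cvg.
- by move=> k; exact: iter_lazy_step_gt0.
- exact: orbit_mean_gt0.
- exact: lazy_step_cvg.
Qed.
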